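(* Let $1\le p<r$ and let $G$ be an $r$-uniform hypergraph with at least one edge. Then there exists a vertex subset $S\subseteq V(G)$ such that the induced sub-hypergraph $G[S]$ is consistently $\alpha$-normal (with exponent $p$) for $\alpha=r^{p-r}/(\lambda^{(p)}(G))^p$. Conversely, \[ \lambda^{(p)}(G)=r^{1-r/p}\max_i\big\{\alpha_i^{-1/p}\big\}, \] where the maximum is taken over all $\alpha_i$ such that some induced sub-hypergraph of $G$ admits a consistent $\alpha_i$-normal labeling (with exponent $p$).
   Context: An $r$-uniform hypergraph $G$ consists of a finite vertex set $V(G)=\{1,\dots,n\}$ and a set $E(G)$ of $r$-element subsets of $V(G)$ (edges). For $S\subseteq V(G)$, the induced sub-hypergraph $G[S]$ has vertex set $S$ and edge set $\{e\in E(G): e\subseteq S\}$. For $\bm{x}\in\mathbb{R}^n$ let $P_G(\bm{x})=r\sum_{\{i_1,\ldots,i_r\}\in E(G)}x_{i_1}\cdots x_{i_r}$, $\|\bm{x}\|_p=(\sum_i|x_i|^p)^{1/p}$, and $\lambda^{(p)}(G)=\max_{\|\bm{x}\|_p=1}P_G(\bm{x})$. A weighted incidence matrix of a hypergraph $H$ is a $|V(H)|\times|E(H)|$ real matrix $B$ with $B(v,e)>0$ if $v\in e$ and $B(v,e)=0$ if $v\notin e$. Given $p$, $H$ is $\alpha$-normal (has an $\alpha$-normal labeling) if there exist a weighted incidence matrix $B$ and positive edge weights $\{w(e)\}_{e\in E(H)}$ with (1) $\sum_{e\in E(H)}w(e)=1$; (2) $\sum_{e\ni v}B(v,e)=1$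 for every $v\in V(H)$; (3) $w(e)^{p-r}\prod_{v\in e}B(v,e)=\alpha$ for every $e\in E(H)$. The labeling $(B,\{w(e)\})$ is consistent if for every vertex $v$ the ratio $w(e)/B(v,e)$ is the same for all edges $e$ containing $v$; $H$ is consistently $\alpha$-normal if it has a consistent $\alpha$-normal labeling. *)

(* Defs.v *)
From HB Require Import structures.
From mathcomp Require Import all_boot all_order all_algebra.
From mathcomp Require Import all_classical all_reals all_analysis.

Set Implicit Arguments.
Unset Strict Implicit.
Unset Printing Implicit Defensive.

Import Order.TTheory GRing.Theory Num.Theory.
Local Open Scope ring_scope.

(* The vertex set is a subset of the ambient labels 'I_n, so that an induced
   sub-hypergraph keeps the vertex names of the hypergraph it comes from. *)
Record hypergraph (r n : nat) := Hypergraph {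
  verts : {set 'I_n};
  edges : {set {set 'I_n}};
  edges_verts : forall e, e \in edges -> e \subset verts;
  edges_card : forall e, e \in edges -> #|e| = r }.

Section Induced.
Variables (r n : nat) (G : hypergraph r n) (S : {set 'I_n}).

Definition induced_edges : {set {set 'I_n}} :=
  finset (fun e => (e \in edges G) && (e \subset S)).

Fact induced_edges_verts e : e \in induced_edges -> e \subset S.
Proof. by rewrite inE => /andP[]. Qed.

Fact induced_edges_card e : e \in induced_edges -> #|e| = r.
Proof. by rewrite inE => /andP[/edges_card]. Qed.

Definition induced_subhypergraph : hypergraph r n :=
  Hypergraph induced_edges_verts induced_edges_card.

End Induced.

Section Defs.
Variable R : realType.

Definition maximums (A : set R) : set R := (A `&` ubound A)%classic.

Definition lp_norm (n : nat) (p : R) (x : 'rV[R]_n) : R :=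
  (\sum_(i < n) `|x ord0 i| `^ p) `^ p^-1.

Definition polyform (r n : nat) (G : hypergraph r n) (x : 'rV[R]_n) : R :=
  r%:R * \sum_(e in edges G) \prod_(i in e) x ord0 i.

(* Meant for verts G = [set: 'I_n], where x ranges over R^V(G). The default
   value 0 of xget is returned only if there is no maximum. *)
Definition lambda_p (r n : nat) (p : R) (G : hypergraph r n) : R :=
  xget 0 (maximums
    [set polyform G x | x in [set x : 'rV[R]_n | lp_norm p x = 1]])%classic.

Section Labelings.
Variables (r n : nat) (p : R) (H : hypergraph r n).

(* Only the values of B on verts H x edges H, and of w on edges H, matter. *)
Implicit Types (B : 'I_n -> {set 'I_n} -> R) (w : {set 'I_n} -> R).

Definition weighted_incidence B : Prop :=
  forall v e, v \in verts H -> e \in edges H ->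
    (v \in e -> 0 < B v e) /\ (v \notin e -> B v e = 0).

Definition normal_labeling (alpha : R) B w : Prop :=
  [/\ weighted_incidence B,
      (forall e, e \in edges H -> 0 < w e),
      \sum_(e in edges H) w e = 1,
      (forall v, v \in verts H -> \sum_(e in edges H | v \in e) B v e = 1) &
      (forall e, e \in edges H ->
         w e `^ (p - r%:R) * \prod_(v in e) B v e = alpha)].

Definition consistent B w : Prop :=
  forall v e f, v \in verts H -> e \in edges H -> f \in edges H ->
    v \in e -> v \in f -> w e / B v e = w f / B v f.

Definition consistently_normal (alpha : R) : Prop :=
  exists B w, normal_labeling alpha B w /\ consistent B w.

End Labelings.

End Defs.

(* Main.v *)
(* Both directions rest on the correspondence
     x_v^p = w(e) / (r B(v, e))     (any edge e containing v),
     B(v, e) = x^e / (lambda x_v^p),   w(e) = r x^e / lambda,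
   where x^e is the product of the x_u over u in e.  A consistent alpha-normal
   labeling of G[S], extended by 0 outside S, gives a unit vector x with
   P_G(x) >= r^(1 - r/p) alpha^(-1/p).  Conversely a nonnegative maximizer x
   satisfies the eigenequations (sum over e containing v of x^e) =
   lambda x_v^p wherever x_v > 0, which make the formulas for B and w a
   consistent labeling of the hypergraph induced on the support of x.  Since
   only positive coordinates are varied, p = 1 needs no separate treatment. *)
Require Import Defs.
From HB Require Import structures.
From mathcomp Require Import all_boot all_order all_algebra.
From mathcomp Require Import all_classical all_reals all_analysis.
From mathcomp Require Import ring.

Set Implicit Arguments.
Unset Strict Implicit.
Unset Printing Implicit Defensive.

Import Order.TTheory GRing.Theory Num.Theory.
Local Open Scope ring_scope.
Import numFieldNormedType.Exports.

Lemma prodr_powR (R : realType) (I : Type) (s : seq I) (P : pred I)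
    (F : I -> R) (t : R) : (forall i, P i -> 0 <= F i) ->
  \prod_(i <- s | P i) F i `^ t = (\prod_(i <- s | P i) F i) `^ t.
Proof.
move=> F0; elim: s => [|i s IH]; first by rewrite !big_nil powR1.
rewrite !big_cons; case: ifPn => // Pi.
by rewrite powRM ?F0 ?prodr_ge0// IH.
Qed.

Lemma hypergraph_order_gt0 (r n : nat) (G : hypergraph r n) :
  (0 < r)%N -> (exists e, e \in edges G) -> (0 < n)%N.
Proof.
move=> r_gt0 [e eG]; rewrite -[n]card_ord; apply: leq_trans r_gt0 _.
by rewrite -(edges_card eG) max_card.
Qed.

(** * Compactness of the unit sphere of the $p$-norm *)

Section SphereMaximum.
Variables (R : realType) (n : nat) (p : R).
Hypothesis p_gt0 : 0 < p.
Implicit Types x : 'rV[R]_n.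

Lemma continuous_norm_powR : continuous (fun t : R => `|t| `^ p).
Proof.
move=> t; have [->|t0] := eqVneq t 0.
  apply/cvgrPdist_lt => e e0; rewrite normr0 powR0 ?gt_eqF//.
  exists (e `^ p^-1) => /=; first exact: powR_gt0.
  move=> s /=; rewrite !sub0r !normrN => se.
  rewrite ger0_norm ?powR_ge0//.
  rewrite -[ltRHS](powRr1 (ltW e0)) -(mulVf (lt0r_neq0 p_gt0)).
  by rewrite powRrM; apply: gt0_ltr_powR; rewrite ?nnegrE ?powR_ge0.
apply: (@continuous_comp R R R (Num.norm : R -> R) ((@powR R)^~ p) t).
  exact: norm_continuous.
apply/differentiable_continuous; rewrite -derivable1_diffP.
by apply: derivable_powR; rewrite in_itv/= andbT normr_gt0.
Qed.

Lemma lp_norm_eq1 x : lp_norm p x = 1 <-> \sum_(i < n) `|x ord0 i| `^ p = 1.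
Proof.
rewrite /lp_norm; split=> [/eqP|->]; last by rewrite powR1.
rewrite powR_eq1 invr_eq0 (gt_eqF p_gt0) orbF => /orP[/eqP//|].
by rewrite ltNge sumr_ge0// => i _; rewrite powR_ge0.
Qed.

(** The sphere is the preimage of a closed point under a continuous map. It lies in a cube because
    one coordinate above 1 in absolute value already pushes the sum past 1. *)
Lemma compact_lp_sphere : compact [set x : 'rV[R]_n | lp_norm p x = 1]%classic.
Proof.
rewrite (_ : [set _ | _]%classic =
    (fun x => \sum_(i < n) `|x ord0 i| `^ p) @^-1` [set 1]%classic)%classic;
  last by apply/seteqP; split=> x /= /lp_norm_eq1.
set Q := fun x : 'rV[R]_n => _.
have cQ : continuous Q.
  apply: continuous_big => [|i _].
    exact: add_continuous.
  move=> x; apply: (@continuous_comp _ _ _ (fun x : 'rV[R]_n => x ord0 i)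
                     (fun t => `|t| `^ p) x).
    exact: coord_continuous.
  exact: continuous_norm_powR.
apply: (@subclosed_compact _ _
  [set x : 'rV[R]_n | forall i, `[-1, 1]%classic (x ord0 i)]%classic).
- by apply: closed_comp => [x _|]; [exact: cQ|exact: closed_eq].
- apply: (@rV_compact R n (fun=> `[-1, 1]%classic)) => _; exact: segment_compact.
- move=> x /= Qx i; rewrite /= in_itv/= -ler_norml leNgt; apply/negP => xi.
  have := @gt0_ltr_powR _ p p_gt0 1 `|x ord0 i|.
  rewrite !nnegrE ler01 normr_ge0 powR1 => /(_ isT isT xi).
  rewrite -{1}Qx /Q (bigD1 i)//= ltNge lerDl sumr_ge0//.
Qed.

End SphereMaximum.

(** * The maximum of the polynomial form: existence, homogeneity, positivity *)

Section Lambda.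
Variables (R : realType) (r n : nat) (p : R) (G : hypergraph r n).
Hypotheses (p_gt0 : 0 < p) (n_gt0 : (0 < n)%N).
Implicit Types x y : 'rV[R]_n.

Lemma continuous_polyform : continuous (@polyform R r n G).
Proof.
suff cS : continuous
    (fun x : 'rV[R]_n => \sum_(e in edges G) \prod_(i in e) x ord0 i).
  move=> x; apply: (@continuousM R _ (fun=> r%:R) _ x); last exact: cS.
  exact: cst_continuous.
apply: continuous_big => [|e _]; first exact: add_continuous.
apply: continuous_big => [|i _]; first exact: mul_continuous.
exact: coord_continuous.
Qed.

(** The extreme value theorem applies, so the default of [xget] is never returned; a basis vector
    shows that the sphere is nonempty. *)
Lemma lambda_p_maximums : maximums
  [set polyform G x | x in [set x : 'rV[R]_n | lp_norm p x = 1]]%classic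
  (lambda_p p G).
Proof.
apply: xgetPex; rewrite /maximums.
have S0 : ([set x : 'rV[R]_n | lp_norm p x = 1] !=set0)%classic.
  exists (delta_mx ord0 (Ordinal n_gt0)); apply/lp_norm_eq1 => //.
  rewrite (bigD1 (Ordinal n_gt0))//= big1 => [|i /negPf ni]; last first.
    by rewrite !mxE eqxx ni normr0 powR0// gt_eqF.
  by rewrite !mxE !eqxx normr1 powR1 addr0.
have [x xS xmax] := EVT_max_rV S0 (@compact_lp_sphere R n p p_gt0)
  (continuous_subspaceT continuous_polyform).
exists (polyform G x); split=> /=.
  by exists x => //; exact: set_mem.
by move=> _ [y ys <-]; apply: xmax; exact: mem_set.
Qed.

Lemma polyform_le_lambda_p x :
  \sum_i `|x ord0 i| `^ p = 1 -> polyform G x <= lambda_p p G.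
Proof.
move=> x1; have [_] := lambda_p_maximums; apply.
by exists x => //; apply/lp_norm_eq1.
Qed.

Lemma polyform_norm_le x :
  polyform G x <= polyform G (\row_i `|x ord0 i|).
Proof.
rewrite /polyform ler_wpM2l//; apply: ler_sum => e _.
rewrite [leRHS](eq_bigr (fun i => `|x ord0 i|)) => [|i _]; last by rewrite mxE.
by rewrite -normr_prod ler_norm.
Qed.

(** Taking absolute values keeps the norm and cannot decrease the form, so it turns a maximizer into
    a nonnegative one. *)
Lemma lambda_p_nonneg_maximizer : exists x : 'rV[R]_n,
  [/\ forall i, 0 <= x ord0 i, \sum_i x ord0 i `^ p = 1 &
      polyform G x = lambda_p p G].
Proof.
have [[x /lp_norm_eq1 -/(_ p_gt0) x1 Px] _] := lambda_p_maximums.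
exists (\row_i `|x ord0 i|).
have y1 : \sum_i (\row_i `|x ord0 i|) ord0 i `^ p = 1.
  by rewrite -[RHS]x1; apply: eq_bigr => i _; rewrite mxE.
split=> // [i|]; first by rewrite mxE.
apply/le_anti; rewrite -{2}Px polyform_norm_le andbT.
apply: polyform_le_lambda_p; rewrite -[RHS]x1.
by apply: eq_bigr => i _; rewrite mxE normr_id.
Qed.

Lemma polyformZ (c : R) x : polyform G (c *: x) = c ^+ r * polyform G x.
Proof.
rewrite /polyform mulrCA; congr (_ * _); rewrite mulr_sumr.
apply: eq_bigr => e /(@edges_card _ _ G) er.
rewrite -[X in c ^+ X]er -prodr_const -big_split/=.
by apply: eq_bigr => i _; rewrite mxE.
Qed.

Lemma polyform_le_powR x : (forall i, 0 <= x ord0 i) ->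
  0 < \sum_i x ord0 i `^ p ->
  polyform G x <= lambda_p p G * (\sum_i x ord0 i `^ p) `^ (r%:R / p).
Proof.
move=> x0; set N := \sum_i _ => N0.
have c0 : 0 < N `^ (- p^-1) by exact: powR_gt0.
have : \sum_i `|(N `^ (- p^-1) *: x) ord0 i| `^ p = 1.
  rewrite (eq_bigr (fun i => N^-1 * x ord0 i `^ p)) => [|i _].
    by rewrite -mulr_sumr -/N mulVf ?gt_eqF.
  rewrite mxE ger0_norm ?mulr_ge0 ?(ltW c0)// powRM ?(ltW c0)//.
  by rewrite -powRrM mulNr mulVf ?gt_eqF// powR_inv1// ltW.
move=> /polyform_le_lambda_p.
rewrite polyformZ -powR_mulrn ?(ltW c0)// -powRrM mulNr powRN.
by rewrite ler_pdivrMl ?powR_gt0// mulrC [p^-1 * _]mulrC.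
Qed.

Lemma lambda_p_gt0 : (0 < r)%N -> (exists e, e \in edges G) -> 0 < lambda_p p G.
Proof.
move=> r0 [e eG].
have n1 : \sum_i (const_mx 1 : 'rV[R]_n) ord0 i `^ p = n%:R.
  rewrite (eq_bigr (fun=> 1)) => [|i _]; last by rewrite mxE powR1.
  by rewrite sumr_const card_ord.
(* The all-ones vector is the test vector: each edge contributes 1 to its form. *)
have := @polyform_le_powR (const_mx 1).
rewrite n1 ltr0n => /(_ _ n_gt0) lam.
have/lam{}lam : forall i, 0 <= (const_mx 1 : 'rV[R]_n) ord0 i.
  by move=> i; rewrite mxE.
rewrite -(pmulr_lgt0 (lambda_p p G) (_ : 0 < n%:R `^ (r%:R / p))); last first.
  by rewrite powR_gt0// ltr0n.
apply: lt_le_trans lam.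
rewrite /polyform mulr_gt0 ?ltr0n// (bigD1 e)//= ltr_pwDl//.
  by rewrite big1// => i _; rewrite mxE.
by apply: sumr_ge0 => f _; apply: prodr_ge0 => i _; rewrite mxE.
Qed.

End Lambda.

(** * From maximizers to consistent labelings and back *)

Section Labeling.
Variables (R : realType) (r n : nat) (p : R) (G : hypergraph r n).
Hypotheses (p_gt0 : 0 < p) (r_gt0 : (0 < r)%N).
Hypothesis edge_ex : exists e, e \in edges G.

Let n_gt0 : (0 < n)%N.
Proof. exact: hypergraph_order_gt0 edge_ex. Qed.

Let lam := lambda_p p G.
Let lam_gt0 : 0 < lam.
Proof. exact: lambda_p_gt0. Qed.

Let edgeprod (x : 'rV[R]_n) (e : {set 'I_n}) := \prod_(i in e) x ord0 i.

(* Scaling the coordinate [v] of the maximizer by [t] leaves the gap in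
   [polyform_le_powR] nonnegative and makes it vanish at [t = 1]; the identity
   says that its derivative there is zero. *)
Lemma maximizer_eigenequation (x : 'rV[R]_n) (v : 'I_n) :
  (forall i, 0 <= x ord0 i) -> \sum_i x ord0 i `^ p = 1 -> polyform G x = lam ->
  0 < x ord0 v ->
  \sum_(e in edges G | v \in e) edgeprod x e = lam * x ord0 v `^ p.
Proof.
move=> x0 x1 Px xv; set A := \sum_(e in _ | _) _; set a := x ord0 v `^ p.
have a0 : 0 < a by exact: powR_gt0.
pose y t : 'rV[R]_n := \row_i ((if i == v then t else 1) * x ord0 i).
have a1 : a <= 1.
  by rewrite -x1 (bigD1 v)//= lerDl sumr_ge0// => i _; exact: powR_ge0.
have y_sum t : 0 < t -> \sum_i y t ord0 i `^ p = (1 - a) + a * t `^ p.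
  move=> t0; have -> : 1 - a = \sum_(i | i != v) x ord0 i `^ p.
    by rewrite -x1 (bigD1 v)//= -/a [a + _]addrC addrK.
  rewrite [RHS]addrC (bigD1 v)//= mxE eqxx powRM// ?(ltW t0)// mulrC; congr (_ + _).
  by apply: eq_bigr => i /negPf iv; rewrite mxE iv mul1r.
(* An edge contains [v] at most once, so the form is affine in [t]. *)
have y_poly t : polyform G (y t) = lam + r%:R * A * (t - 1).
  rewrite -Px /polyform -mulrA -mulrDr; congr (_ * _).
  rewrite (bigID (fun e : {set 'I_n} => v \in e))/=.
  rewrite [X in _ = X + _](bigID (fun e : {set 'I_n} => v \in e))/=.
  rewrite addrAC; congr (_ + _); last first.
    apply: eq_bigr => e /andP[_ ve]; apply: eq_bigr => i ie.
    have /negPf iv : i != v by apply: contraNneq ve => <-.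
    by rewrite mxE iv mul1r.
  change (\sum_(e in edges G | v \in e) edgeprod (y t) e = A + A * (t - 1)).
  rewrite (_ : A + _ = t * A); last by ring.
  rewrite /A mulr_sumr; apply: eq_bigr => e /andP[_ ve].
  rewrite /edgeprod (bigD1 v)//= [X in _ = _ * X](bigD1 v)//= mulrA mxE eqxx.
  by congr (_ * _); apply: eq_bigr => i /andP[_ /negPf iv]; rewrite mxE iv mul1r.
pose s := r%:R / p.
pose f t := lam * ((1 - a) + a * t `^ p) `^ s - (lam + r%:R * A * (t - 1)).
have inner_gt0 (t : R) : 0 < t -> 0 < (1 - a) + a * t `^ p.
  by move=> t0; rewrite ltr_wpDl ?subr_ge0// mulr_gt0// powR_gt0.
have f_derive (t : R) : 0 < t -> is_derive t 1 f
  (lam * (s * ((1 - a) + a * t `^ p) `^ (s - 1) * (a * (p * t `^ (p - 1)))) -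
   r%:R * A).
  move=> t0; have it0 := inner_gt0 _ t0.
  have di : is_derive t 1 (fun t => (1 - a) + a * t `^ p) (a * (p * t `^ (p - 1))).
    have := is_deriveD (is_derive_cst (1 - a) t 1)
      (is_deriveZ a (is_derive1_powR p t0)).
    by rewrite add0r.
  have dc := @is_derive1_comp _ ((@powR R)^~ s) _ t _ _ (is_derive1_powR s it0) di.
  have := is_deriveB (is_deriveZ lam dc)
    (* The affine part of [f] is regrouped as a constant plus a multiple of [t]. *)
    (is_deriveD (is_derive_cst (lam - r%:R * A) t 1)
       (is_deriveZ (r%:R * A) (is_derive_id t 1))).
  rewrite add0r [_ *: 1]mulr1.
  rewrite (_ : _ - _ = f); last first.
    by apply/funext => u; rewrite /f !fctE/= /GRing.scale/=; ring.
  by [].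
have f1 : f 1 = 0.
  by rewrite /f powR1 mulr1 !subrK powR1 subrr mulr0 addr0 mulr1 subrr.
have f_ge0 (t : R) : 0 < t -> 0 <= f t.
  move=> t0; rewrite subr_ge0 -y_poly -y_sum//; apply: polyform_le_powR => //.
    by move=> i; rewrite mxE mulr_ge0//; case: ifP => // _; exact: ltW.
  by rewrite y_sum// inner_gt0.
have d0 : is_derive (1 : R) 1 f 0.
  (* The interval from 0 to 2 has 1 in its interior and stays where [f] is differentiable. *)
  apply: (@derive1_at_min _ f 0 2); rewrite ?in_itv/= ?ltr01 ?ltr1n//.
    by move=> t; rewrite in_itv/= => /andP[t0 _]; have [] := f_derive t t0.
  by move=> t; rewrite in_itv/= => /andP[t0 _]; rewrite f1 f_ge0.
have := @derive_val _ _ _ _ _ _ _ d0; have [_ ->] := f_derive 1 ltr01.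
rewrite !powR1 !mulr1 subrK powR1 mulr1 => /eqP.
have -> : lam * (s * (a * p)) - r%:R * A = r%:R * (lam * a - A).
  by rewrite /s; field; rewrite gt_eqF.
by rewrite mulf_eq0 pnatr_eq0 gtn_eqF//= subr_eq0 => /eqP.
Qed.

Lemma consistently_normal_support (x : 'rV[R]_n) :
  (forall i, 0 <= x ord0 i) -> \sum_i x ord0 i `^ p = 1 -> polyform G x = lam ->
  consistently_normal p
    (induced_subhypergraph G [set i | 0 < x ord0 i]%SET)
    (r%:R `^ (p - r%:R) / lam `^ p).
Proof.
move=> x0 x1 Px; set S := [set i | _]%SET.
have r0 : 0 < r%:R :> R by rewrite ltr0n.
have xS i : i \in S -> 0 < x ord0 i by rewrite inE.
have edge_gt0 (e : {set 'I_n}) : e \subset S -> 0 < edgeprod x e.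
  by move=> /fintype.subsetP eS; apply: prodr_gt0 => i /eS; exact: xS.
have edge_eq0 (e : {set 'I_n}) : ~~ (e \subset S) -> edgeprod x e = 0.
  move=> /fintype.subsetPn[i ie]; rewrite inE -leNgt => xi.
  by apply/eqP/prodf_eq0; exists i => //; rewrite eq_le xi x0.
(* Edges leaving the support have product 0, so sums over $G$ and over $G[S]$ agree. *)
have sum_induced (P : pred {set 'I_n}) :
    \sum_(e in induced_edges G S | P e) edgeprod x e =
    \sum_(e in edges G | P e) edgeprod x e.
  rewrite [RHS](bigID (fun e : {set 'I_n} => e \subset S))/= [X in _ + X]big1 ?addr0.
    by apply: eq_bigl => e; rewrite inE andbAC.
  by move=> e /andP[_]; exact: edge_eq0.
exists (fun v (e : {set 'I_n}) =>
    if v \in e then edgeprod x e / (lam * x ord0 v `^ p) else 0),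
  (fun e => r%:R * edgeprod x e / lam); split; [split|].
- move=> v e /xS xv; rewrite inE => /andP[_ /edge_gt0 ee]; split => [->|/negPf->//].
  by rewrite divr_gt0// mulr_gt0// powR_gt0.
- move=> e; rewrite inE => /andP[_ /edge_gt0 ee].
  by rewrite divr_gt0// mulr_gt0.
- rewrite -mulr_suml -mulr_sumr; have := sum_induced xpredT.
  under eq_bigl do rewrite andbT; under [RHS]eq_bigl do rewrite andbT.
  by move=> ->; rewrite -/(polyform G x) Px divff ?gt_eqF.
- move=> v /xS xv; rewrite (eq_bigr (fun e => edgeprod x e / (lam * x ord0 v `^ p))).
    rewrite -mulr_suml sum_induced maximizer_eigenequation// divff// gt_eqF//.
    by rewrite mulr_gt0// powR_gt0.
  by move=> e /andP[_ ->].
(* The product of the $B(v,e)$ is $(x^e/\lambda)^r/(x^e)^p$; multiplied by $w(e)^{p-r}$ it loses all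
   dependence on $x^e$. *)
- move=> e; rewrite inE => /andP[eG eS]; have ee := edge_gt0 e eS.
  rewrite (eq_bigr (fun v => (edgeprod x e / lam) / x ord0 v `^ p)); last first.
    by move=> v ->; rewrite invfM mulrA.
  have prod_powR (t : R) : \prod_(v in e) x ord0 v `^ t = edgeprod x e `^ t.
    exact: prodr_powR.
  rewrite big_split/= prodr_const (edges_card eG) prodfV prod_powR.
  rewrite -powR_mulrn ?divr_ge0 ?(ltW ee) ?(ltW lam_gt0)//.
  rewrite -mulrA powRM ?divr_ge0 ?(ltW ee) ?(ltW lam_gt0)// ?(ltW r0)//.
  have el0 : 0 < edgeprod x e / lam by rewrite divr_gt0.
  rewrite -!mulrA; congr (_ * _).
  rewrite mulrA -powRD ?(gt_eqF el0) ?implybT// subrK.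
  rewrite powRM ?invr_ge0 ?(ltW ee) ?(ltW lam_gt0)//.
  rewrite mulrAC divff ?gt_eqF ?powR_gt0// mul1r.
  by rewrite -powR_inv1 ?(ltW lam_gt0)// -powRrM mulN1r powRN.
(* The ratio is $r x_v^p$ for every edge at $v$. *)
- move=> v e f /xS xv; rewrite !inE => /andP[_ /edge_gt0 ee] /andP[_ /edge_gt0 ff].
  move=> -> ->; field.
  by rewrite !gt_eqF// powR_gt0.
Qed.

Lemma consistently_normal_le (S : {set 'I_n}) (alpha : R) :
  consistently_normal p (induced_subhypergraph G S) alpha ->
  r%:R `^ (1 - r%:R / p) * alpha `^ (- p^-1) <= lam.
Proof.
move=> [B [w [[/= incB w_gt0 w_sum B_sum labelE] /= consB]]].
have r0 : 0 < r%:R :> R by rewrite ltr0n.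
set E := induced_edges G S in incB w_gt0 w_sum B_sum labelE consB.
have subE e : e \in E -> e \subset S by exact: induced_edges_verts.
have B_gt0 v e : e \in E -> v \in e -> 0 < B v e.
  move=> eE ve; have vS := fintype.subsetP (subE e eE) v ve.
  exact: (incB v e vS eE).1.
(* [z v] is the future $x_v^p$; it is 0 at vertices on no edge of $G[S]$, in particular outside [S].
   Consistency makes the picked edge irrelevant. *)
pose z v := if [pick e in E | v \in e] is Some e then w e / (r%:R * B v e) else 0.
have zE v e : e \in E -> v \in e -> z v = w e / (r%:R * B v e).
  move=> eE ve; rewrite /z.
  case: pickP => [f /andP[fE vf]|/(_ e)]; last by rewrite eE ve.
  rewrite !invfM !mulrA ![_ / r%:R / _]mulrAC; congr (_ / _).
  by apply: consB => //; exact: fintype.subsetP (subE e eE) v ve.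
have z_ge0 v : 0 <= z v.
  rewrite /z; case: pickP => // e /andP[eE ve].
  by rewrite divr_ge0 ?mulr_ge0 ?ltW// ?w_gt0// B_gt0.
have zp v : (z v `^ p^-1) `^ p = z v by rewrite -powRrM mulVf ?gt_eqF// powRr1.
have z_sum : \sum_v z v = 1.
  (* Weighting by $\sum_e B(v,e)=1$ replaces [z v] by a sum of $w(e)/r$; exchanging the sums then
     counts each edge once for each of its [r] vertices. *)
  have zB v : z v = \sum_(e in E | v \in e) w e / r%:R.
    have [vS|vS] := boolP (v \in S); last first.
      rewrite big_pred0 => [|e]; last first.
        by apply/negP => /andP[/subE/fintype.subsetP eS /eS]; exact/negP.
      rewrite /z; case: pickP => // e /andP[/subE/fintype.subsetP eS /eS].
      by rewrite (negPf vS).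
    rewrite -[LHS]mulr1 -[X in _ * X](B_sum v vS) mulr_sumr.
    apply: eq_bigr => e /andP[eE ve].
    by rewrite (zE v e)//; field; rewrite !gt_eqF// B_gt0.
  under eq_bigr do rewrite zB.
  rewrite (exchange_big_dep (mem E))//=; last by move=> ? ? _ /andP[].
  rewrite -[RHS]w_sum; apply: eq_bigr => e eE.
  rewrite (eq_bigl (mem e)); last by move=> v; rewrite eE.
  rewrite sumr_const (@edges_card _ _ (induced_subhypergraph G S) e eE).
  by rewrite -[LHS]mulr_natr divfK// gt_eqF.
pose x : 'rV[R]_n := \row_v z v `^ p^-1.
have x_ge0 i : 0 <= x ord0 i by rewrite mxE powR_ge0.
have x_sum : \sum_i `|x ord0 i| `^ p = 1.
  by rewrite -[RHS]z_sum; apply: eq_bigr => i _; rewrite ger0_norm// mxE zp.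
(* Every $x^e$ is the same multiple of $w(e)$, so the total weight 1 evaluates the form on
   $G[S]$. *)
have e0 e : e \in E ->
    edgeprod x e = w e * r%:R `^ (- (r%:R / p)) * alpha `^ (- p^-1).
  move=> eE; have we := w_gt0 e eE.
  have b0 : 0 < \prod_(v in e) B v e by apply: prodr_gt0 => v; exact: B_gt0.
  have -> : edgeprod x e = (\prod_(v in e) z v) `^ p^-1.
    by rewrite -prodr_powR// /edgeprod; apply: eq_bigr => v _; rewrite mxE.
  rewrite (eq_bigr (fun v => (w e / r%:R) / B v e)) => [|v ve]; last first.
    by rewrite (zE v e)// invfM mulrA.
  rewrite big_split/= prodr_const (@edges_card _ _ (induced_subhypergraph G S) e eE).
  have -> : \prod_(v in e) (B v e)^-1 = w e `^ (p - r%:R) / alpha.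
    rewrite prodfV -(labelE e eE) invfM mulrA divff ?mul1r//.
    by rewrite gt_eqF// powR_gt0.
  have al0 : 0 < alpha by rewrite -(labelE e eE) mulr_gt0// powR_gt0.
  rewrite -powR_mulrn ?divr_ge0 ?ltW//.
  rewrite powRM ?invr_ge0 ?(ltW we) ?(ltW r0)//.
  rewrite -(powR_inv1 (ltW r0)) -(powR_inv1 (ltW al0)) -!powRrM !mulN1r.
  have -> : w e `^ r%:R * r%:R `^ (- r%:R) * (w e `^ (p - r%:R) * alpha `^ (-1)) =
    w e `^ p * (r%:R `^ (- r%:R) * alpha `^ (-1)).
    rewrite mulrACA -powRD; last by rewrite (gt_eqF we) implybT.
    by rewrite addrC subrK.
  rewrite !powRM ?mulr_ge0 ?powR_ge0// -!powRrM divff ?gt_eqF// powRr1 ?(ltW we)//.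
  by rewrite mulN1r mulNr mulrA.
apply: le_trans (polyform_le_lambda_p G p_gt0 n_gt0 x_sum).
rewrite /polyform (bigID (fun e : {set 'I_n} => e \subset S))/= mulrDr.
rewrite -[leLHS]addr0 lerD//; last first.
  rewrite mulr_ge0 ?(ltW r0)// sumr_ge0// => e _.
  exact: prodr_ge0.
rewrite (eq_bigl (mem E)) => [|e]; last by rewrite !inE.
rewrite (eq_bigr _ e0) -!mulr_suml w_sum mul1r mulrA.
by rewrite powRD ?powRr1 ?(ltW r0)// (gt_eqF r0) implybT.
Qed.

End Labeling.

Theorem theorem4p1 (R : realType) (r n : nat) (p : R) (G : hypergraph r n)
    (hp1 : 1 <= p) (hpr : p < r%:R)
    (hV : verts G = [set: 'I_n]%SET) (hE : exists e, e \in edges G) :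
  (exists S : {set 'I_n}, S \subset verts G /\
     consistently_normal p (induced_subhypergraph G S)
       (r%:R `^ (p - r%:R) / lambda_p p G `^ p)) /\
  (exists m : R,
     maximums
       [set alpha `^ (- p^-1) | alpha in
          [set alpha : R | exists S : {set 'I_n}, S \subset verts G /\
             consistently_normal p (induced_subhypergraph G S) alpha]]%classic m /\
     lambda_p p G = r%:R `^ (1 - r%:R / p) * m).
Proof.
have p0 : 0 < p by exact: lt_le_trans hp1.
have r0 : 0 < r%:R :> R by exact: lt_trans hpr.
have r0n : (0 < r)%N by rewrite -(ltr0n R).
have n0 := hypergraph_order_gt0 r0n hE.
have lam0 := lambda_p_gt0 p0 n0 r0n hE.
have [x [x0 x1 Px]] := lambda_p_nonneg_maximizer G p0 n0.
have normS := consistently_normal_support p0 r0n hE x0 x1 Px.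
set S := [set i | _]%SET in normS.
have SG : S \subset verts G by rewrite hV finset.subsetT.
split; first by exists S.
(* Solving $\alpha = r^{p-r}/\lambda^p$ for $\lambda$ shows that the labeling from the maximizer
   attains the bound. *)
have lamE : lambda_p p G = r%:R `^ (1 - r%:R / p) *
    (r%:R `^ (p - r%:R) / lambda_p p G `^ p) `^ (- p^-1).
  rewrite powRM ?invr_ge0 ?powR_ge0// -[(_ `^ p)^-1]powRN -!powRrM.
  rewrite mulrNN divff ?gt_eqF// powRr1 ?(ltW lam0)//.
  rewrite mulrA -powRD ?(gt_eqF r0) ?implybT//.
  have -> : 1 - r%:R / p + (p - r%:R) * - p^-1 = 0 by field; rewrite gt_eqF.
  by rewrite powRr0 mul1r.
exists ((r%:R `^ (p - r%:R) / lambda_p p G `^ p) `^ (- p^-1)); split=> //.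
split; first by exists (r%:R `^ (p - r%:R) / lambda_p p G `^ p) => //; exists S.
move=> _ [alpha [T [_ /(consistently_normal_le p0 r0n hE) le_lam]] <-].
by rewrite lamE ler_pM2l ?powR_gt0 in le_lam.
Qed.
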